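(* Let $\pi$ be a permutation of $\mathbb{F}_2^m$, $m\ge4$, which has the property $(P_1)$ (for all linearly independent $v,w\in\mathbb{F}_2^m$, the function $D_vD_w\pi$ is not the constant zero function) and which additionally satisfies the condition that $a_1\cdot D_{b_2}\pi(y)\neq0$ for any nonzero $a_1,b_2\in\mathbb{F}_2^m$ (that is, the function $y\mapsto a_1\cdot D_{b_2}\pi(y)$ is not the constant zero function). Then the bent function $f(x,y)=x\cdot\pi(y)+\delta_0(x)$, where $x,y\in\mathbb{F}_2^m$, is outside $\mathcal{M}^{\#}$ and is also $\ell$-optimal, since $\operatorname{r-ind}(f)=1$. In particular, the same is true if $\deg(\pi)>2$ and $\pi$ is a monomial permutation satisfying $(P_1)$.
   Context: $\cdot$ is the standard scalar product over $\mathbb{F}_2$. $\delta_0(x)=\prod_{i=1}^m(x_i+1)$ is the indicator function of $\{0_m\}$. For a function $F$: $D_aF(x)=F(x+a)+F(x)$ and $D_aD_bF(x)=F(x+a+b)+F(x+a)+F(x+b)+F(x)$. $\deg(\pi)$ is the maximum algebraic degree of the coordinate functions of $\pi$. A monomial permutation is a permutation of the form $y\mapsto y^d$ on the finite field $\mathbb{F}_{2^m}$, which is identified with $\mathbb{F}_2^m$ as a vector space; in the finite field setting $x\cdot y$ may be taken to be the absolute trace $Tr(xy)$. A Boolean function $f$ on $\mathbb{F}_2^n$ ($n$ even) is bent if $\sum_{x}(-1)^{f(x)+u\cdot x}=\pm 2^{n/2}$ for all $u\in\mathbb{F}_2^n$. A linear subspace $U$ of $\mathbb{F}_2^n$ is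 an $\mathcal{M}$-subspace of $f$ if $D_aD_bf$ is identically $0$ for all $a,b\in U$, and a relaxed $\mathcal{M}$-subspace if for all $a,b\in U$ the function $D_aD_bf$ is constant (zero or one). $\operatorname{ind}(f)$ and $\operatorname{r-ind}(f)$ are the maximal dimensions of an $\mathcal{M}$-subspace and of a relaxed $\mathcal{M}$-subspace of $f$, respectively. A bent function $f$ is $\ell$-optimal if $\operatorname{ind}(f)=1$. The Maiorana-McFarland class $\mathcal{M}$ in $2m$ variables is the set of functions $x\cdot\sigma(y)+h(y)$, $x,y\in\mathbb{F}_2^m$, with $\sigma$ a permutation of $\mathbb{F}_2^m$ and $h$ an arbitrary Boolean function on $\mathbb{F}_2^m$; $\mathcal{M}^{\#}$ is the set of all functions EA-equivalent to a function in $\mathcal{M}$ ($f,f'$ are EA-equivalent if $f'=f\circ A+l$ with $A$ an affine permutation and $l$ an affine Boolean function).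
   Formalization: In the general part r-ind(f)=1 is claimed only if also no a_1·D_{b_2}π (a_1,b_2 nonzero) is constantly one; without this it fails, e.g. for π(y)=y^3 on F_32. Bentness, being outside M^# and ℓ-optimality keep the printed hypotheses. *)

(* Defs.v *)
From HB Require Import structures.
From mathcomp Require Import all_boot all_order all_fingroup all_algebra all_field.

Set Implicit Arguments.
Unset Strict Implicit.
Unset Printing Implicit Defensive.

Import GRing.Theory Num.Theory.
Local Open Scope ring_scope.

Definition dot (n : nat) (u v : 'rV['F_2]_n) : 'F_2 :=
  \sum_(i < n) u 0 i * v 0 i.

Definition delta0 (m : nat) (x : 'rV['F_2]_m) : 'F_2 :=
  \prod_(i < m) (x 0 i + 1).

(* F_2 has characteristic 2: the sums below could also be written as
   differences. *)
Definition derive (U V : zmodType) (a : U) (F : U -> V) : U -> V :=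
  fun x => F (x + a) + F x.

Definition property_P1 (m : nat) (F : 'rV['F_2]_m -> 'rV['F_2]_m) : Prop :=
  forall v w : 'rV['F_2]_m, free [:: v; w] ->
    ~ (forall y, derive v (derive w F) y = 0).

(* The algebraic degree is read off the algebraic normal form
   f(x) = \sum_I c_I \prod_(i in I) x_i, whose coefficient family c is
   uniquely determined by f. *)
Definition anf_eval (m : nat) (c : {ffun {set 'I_m} -> 'F_2})
    (x : 'rV['F_2]_m) : 'F_2 :=
  \sum_(I : {set 'I_m}) c I * \prod_(i in I) x 0 i.

Definition alg_degree (m : nat) (f : 'rV['F_2]_m -> 'F_2) : nat :=
  \max_(c : {ffun {set 'I_m} -> 'F_2} | [forall x, anf_eval c x == f x])
    \max_(I : {set 'I_m} | (c I != 0)%R) #|I|.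

Definition vec_degree (m : nat) (F : 'rV['F_2]_m -> 'rV['F_2]_m) : nat :=
  \max_(i < m) alg_degree (fun y => (F y 0 i)%R).

Definition bent (n : nat) (f : 'rV['F_2]_n -> 'F_2) : Prop :=
  ~~ odd n /\
  forall u : 'rV['F_2]_n,
    let W : int := \sum_(x : 'rV['F_2]_n) (-1) ^+ nat_of_ord (f x + dot u x) in
    W = 2 ^+ n./2 \/ W = - 2 ^+ n./2.

Definition M_subspace (n : nat) (f : 'rV['F_2]_n -> 'F_2)
    (U : {vspace 'rV['F_2]_n}) : bool :=
  [forall a, forall b, (a \in U) ==> (b \in U) ==>
    [forall x, derive a (derive b f) x == 0]].

Definition relaxed_M_subspace (n : nat) (f : 'rV['F_2]_n -> 'F_2)
    (U : {vspace 'rV['F_2]_n}) : bool :=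
  [forall a, forall b, (a \in U) ==> (b \in U) ==>
    [exists c : 'F_2, forall x, derive a (derive b f) x == c]].

(* Every subspace of F_2^n is spanned by some n vectors, so the tuples X below
   range over all subspaces. *)
Definition ind (n : nat) (f : 'rV['F_2]_n -> 'F_2) : nat :=
  \max_(X : n.-tuple 'rV['F_2]_n | M_subspace f <<X>>%VS) \dim <<X>>%VS.

Definition r_ind (n : nat) (f : 'rV['F_2]_n -> 'F_2) : nat :=
  \max_(X : n.-tuple 'rV['F_2]_n | relaxed_M_subspace f <<X>>%VS)
    \dim <<X>>%VS.

Definition l_optimal (n : nat) (f : 'rV['F_2]_n -> 'F_2) : Prop :=
  bent f /\ ind f = 1%N.

(* A pair (x, y) of vectors of F_2^m is the row vector z = row_mx x y of
   F_2^(m + m), with x = lsubmx z and y = rsubmx z. *)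
Definition class_MM (m : nat) (f : 'rV['F_2]_(m + m) -> 'F_2) : Prop :=
  exists (sigma : {perm 'rV['F_2]_m}) (h : 'rV['F_2]_m -> 'F_2),
    forall z, f z = dot (lsubmx z) (sigma (rsubmx z)) + h (rsubmx z).

Definition EA_equivalent (n : nat) (f g : 'rV['F_2]_n -> 'F_2) : Prop :=
  exists (A : 'M['F_2]_n) (c u : 'rV['F_2]_n) (e : 'F_2),
    A \in unitmx /\ forall z, g z = f (z *m A + c) + (dot u z + e).

Definition class_MM_sharp (m : nat) (f : 'rV['F_2]_(m + m) -> 'F_2) : Prop :=
  exists g : 'rV['F_2]_(m + m) -> 'F_2, class_MM g /\ EA_equivalent g f.

(* The function x . F(y) + delta_0(x), for a scalar product sp. *)
Definition D0_fun (m : nat) (sp : 'rV['F_2]_m -> 'rV['F_2]_m -> 'F_2)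
    (F : 'rV['F_2]_m -> 'rV['F_2]_m) (z : 'rV['F_2]_(m + m)) : 'F_2 :=
  sp (lsubmx z) (F (rsubmx z)) + delta0 (lsubmx z).

(* A field extension L of F_2 with a linear bijection psi from F_2^m to L is
   the field with 2^m elements, identified with F_2^m as a vector space. *)

(* The sum of the conjugates of z lies in the prime field; abs_trace is the
   corresponding element of F_2, and the default value 0 is never used. *)
Definition abs_trace (L : fieldExtType 'F_2) (m : nat) (z : L) : 'F_2 :=
  odflt 0 [pick t : 'F_2 | t%:A == \sum_(i < m) z ^+ (2 ^ i)].

Definition trace_dot (L : fieldExtType 'F_2) (m : nat)
    (psi : 'rV['F_2]_m -> L) (u v : 'rV['F_2]_m) : 'F_2 :=
  abs_trace m (psi u * psi v).

Definition monomial_via (L : fieldExtType 'F_2) (m : nat)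
    (psi : 'rV['F_2]_m -> L) (d : nat) (F : 'rV['F_2]_m -> 'rV['F_2]_m)
    : Prop :=
  forall y, psi (F y) = psi y ^+ d.

(* Main.v *)
Require Import Defs.
From HB Require Import structures.
From mathcomp Require Import all_boot all_order all_fingroup all_algebra all_field.
From mathcomp Require Import ring zify.
Import GRing.Theory Num.Theory.
Local Open Scope ring_scope.
Set Implicit Arguments.
Unset Strict Implicit.
Unset Printing Implicit Defensive.

(** Write f(x,y) = x.P(y) + delta_0(x) with P a permutation.

    Bentness: the Walsh transform of x.P(y) at (u1,u2) is
    2^m (-1)^(u2.P^-1(u1)), and adding delta_0 changes it only for u2 = 0,
    where it goes from 2^m to 2^m - 2.2^m = -2^m.

    Indices: suppose that D_a D_b f is a constant c for linearly independent
    a = (a1,a2) and b = (b1,b2).  For fixed y this derivative is an affine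
    function of x plus D_a1 D_b1 delta_0.  If a1, b1 are independent, the
    latter is the indicator of a set of 4 points, which is not affine in
    dimension m >= 4; so a1, b1 are dependent, the term in delta_0 vanishes,
    and the linear part D_a2 D_b2 P must vanish, so that (P_1) makes a2, b2
    dependent as well.  Hence the plane spanned by a and b contains some (w,0)
    and some (0,u), both nonzero, and D_a D_b f, which depends only on the
    plane, is w.D_u P(y) (constant_derive2_spiked).  The hypotheses on P forbid
    c = 0, resp. every c, which bounds ind and r-ind by 1.  A function in
    M^# is annihilated by the second derivatives along an m-dimensional space,
    which is excluded too.

    Monomials: let pi be z |-> z^d on the field L with 2^m elements, D the set
    of positions of the binary digits 1 of d modulo 2^m - 1, and z^J the product of the conjugates z^(2^i) for i
    in J.  The functions z^J are linearly independent.  If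
    Tr(lambda ((z+b)^d + z^d)) is constant, then substituting z = b t and
    expanding show that the weights e_k = (lambda b^d)^(2^k) of the cyclic
    shifts D+k satisfy: the sum of the e_k over all k with N contained in D+k
    is 0 for every nonempty N with fewer than w = #|D| elements.  By
    inclusion-exclusion the same holds for the sum over the shifts selected by
    fewer than w conditions (j in D+k) or (j not in D+k), at least one of them
    positive.  But w shifts contain 0, and each further condition can be chosen
    so as to at least halve the selected family without emptying it (the shifts
    are distinct because z |-> z^d is injective).  As w < 2^(w-1) for w >= 3,
    w - 2 further conditions leave a single shift, whose weight is nonzero: a
    contradiction (trace_derive_monomial_nonconstant).  Finally #|D| >= 3
    because the degree of pi is at most #|D|.

    Both scalar products are covered by one case, because Tr(u v) = (T u).v for
    a linear bijection T (dot_trace_dual): the trace form with pi is the dot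
    product with T o pi. *)

(** * Vectors over the field with two elements *)

Lemma F2_cases (c : 'F_2) : c = 0 \/ c = 1.
Proof. by case: c => [[|[|n]] hn] //; [left | right]; apply: val_inj. Qed.

Lemma addF2 (c : 'F_2) : c + c = 0.
Proof. exact: (addrr_pchar2 (pchar_Fp (isT : prime 2))). Qed.

Lemma addrr2 n (v : 'rV['F_2]_n) : v + v = 0.
Proof. by apply/rowP=> i; rewrite !mxE addF2. Qed.

Lemma addrK2 n (v w : 'rV['F_2]_n) : v + w + w = v.
Proof. by rewrite -addrA addrr2 addr0. Qed.

Lemma addr2_eq0 n (v w : 'rV['F_2]_n) : (v + w == 0) = (v == w).
Proof.
apply/eqP/eqP => [h|->]; last exact: addrr2.
by rewrite -[v](addrK2 v w) h add0r.
Qed.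

Lemma free2_F2 n (v w : 'rV['F_2]_n) :
  free [:: v; w] = [&& v != 0, w != 0 & v != w].
Proof.
rewrite free_cons span_seq1 seq1_free andbC.
have [-> | w0] /= := eqVneq w 0; first by rewrite andbF.
have -> : (v \in <[w]>%VS) = (v == 0) || (v == w).
  apply/vlineP/orP => [[k ->] | [] /eqP ->].
  - by case: (F2_cases k) => ->; rewrite ?scale0r ?scale1r eqxx; auto.
  - by exists 0; rewrite scale0r.
  - by exists 1; rewrite scale1r.
by rewrite negb_or.
Qed.

Lemma exists_notin m (hm : (4 <= m)%N) (s : seq 'rV['F_2]_m) :
  (size s < 16)%N -> exists u, u \notin s.
Proof.
move=> hs; case: (pickP [pred u | u \notin s]) => [u hu | h]; first by exists u.
have: (#|'rV['F_2]_m| <= size s)%N.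
  apply: leq_trans (card_size s); apply: subset_leq_card.
  by apply/subsetP => u _; move/negbFE: (h u).
rewrite card_mx card_Fp // mul1n => h1.
have := leq_pexp2l (isT : (0 < 2)%N) hm; lia.
Qed.

Section Dot.

Variable m : nat.
Implicit Types u v w : 'rV['F_2]_m.

Lemma dotDl u v w : dot (u + v) w = dot u w + dot v w.
Proof.
by rewrite /dot -big_split; apply: eq_bigr => i _; rewrite mxE mulrDl.
Qed.

Lemma dotC u v : dot u v = dot v u.
Proof. by apply: eq_bigr => i _; rewrite mulrC. Qed.

Lemma dotDr u v w : dot u (v + w) = dot u v + dot u w.
Proof. by rewrite dotC dotDl !(dotC u). Qed.

Lemma dot0l u : dot 0 u = 0.
Proof. by rewrite /dot big1 // => i _; rewrite mxE mul0r. Qed.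

Lemma dot0r u : dot u 0 = 0.
Proof. by rewrite dotC dot0l. Qed.

Lemma dot_delta u i : dot u (delta_mx 0 i) = u 0 i.
Proof.
rewrite /dot (bigD1 i) //= mxE !eqxx mulr1 big1 ?addr0 // => j hj.
by rewrite mxE (negPf hj) andbF mulr0.
Qed.

Lemma dot_nondeg u : (forall v, dot u v = 0) -> u = 0.
Proof. by move=> h; apply/rowP => i; rewrite -dot_delta h mxE. Qed.

Lemma delta0E u : delta0 u = (u == 0)%:R.
Proof.
rewrite /delta0; have [-> | nz] := eqVneq u 0.
  by rewrite big1 // => i _; rewrite mxE add0r.
case: (pickP (fun i => u 0 i != 0)) => [i hi | h].
  case: (F2_cases (u 0 i)) hi => [-> | hi _]; first by rewrite eqxx.
  by rewrite (bigD1 i) //= hi addF2 mul0r.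
case/eqP: nz; apply/rowP => i; rewrite mxE; apply/eqP.
by rewrite -[_ == _]negbK h.
Qed.

End Dot.

Lemma dot_row_mx m (u z : 'rV['F_2]_(m + m)) :
  dot u z = dot (lsubmx u) (lsubmx z) + dot (rsubmx u) (rsubmx z).
Proof.
by rewrite /dot big_split_ord; congr (_ + _);
  apply: eq_bigr => i _; rewrite !mxE.
Qed.

(** * Second derivatives *)

Lemma derive2E n (g : 'rV['F_2]_n -> 'F_2) (a b z : 'rV['F_2]_n) :
  derive a (derive b g) z = g (z + a + b) + g (z + a) + (g (z + b) + g z).
Proof. by []. Qed.

Lemma derive2_dependent n (g : 'rV['F_2]_n -> 'F_2) (a b x : 'rV['F_2]_n) :
  ~~ free [:: a; b] -> derive a (derive b g) x = 0.
Proof.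
rewrite free2_F2 !negb_and !negbK derive2E => /or3P [] /eqP ->.
- by rewrite !addr0 addF2.
- by rewrite !addr0 !addF2.
- by rewrite addrK2 [g x + _]addrC addF2.
Qed.

(** For independent directions a second derivative depends only on the plane
    they span: it is the sum of the values over a coset of that plane. *)
Lemma derive2_span n (g : 'rV['F_2]_n -> 'F_2) (a b u w z : 'rV['F_2]_n) :
    u \in [:: a; b; a + b] -> w \in [:: a; b; a + b] -> u != w ->
  derive u (derive w g) z = derive a (derive b g) z.
Proof.
have zba : z + b + a = z + a + b by rewrite addrAC.
rewrite !inE !derive2E => /or3P [] /eqP -> /or3P [] /eqP ->;
  rewrite ?eqxx // => _; rewrite ?addrA ?zba ?addrK2; try ring.
all: rewrite ?(addrAC _ a a) ?(addrAC _ b a) ?(addrAC _ b b) ?addrK2; ring.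
Qed.

(** The second derivative of [delta0] is the indicator of a plane V.  If it were
    affine, V would be the kernel of a linear form, but V has index at least 4
    and thus two different nontrivial cosets: a linear form which is 1 on both
    of them is 0 on their sum. *)
Lemma two_flat_indicator_not_affine m (hm : (4 <= m)%N)
    (a b p : 'rV['F_2]_m) (q c : 'F_2) :
    a != 0 -> b != 0 -> a != b ->
  ~ (forall x, dot x p + q + derive a (derive b (@delta0 m)) x = c).
Proof.
move=> a0 b0 ab h.
pose V := [:: 0; a; b; a + b].
have DDE x : derive a (derive b (@delta0 m)) x = (x \in V)%:R.
  rewrite /derive -(addrA x) !delta0E !addr2_eq0 !inE.
  have [-> | x0] := eqVneq x 0.
    rewrite ![0 == _]eq_sym (negPf a0) (negPf b0) addr2_eq0 (negPf ab).
    by rewrite ?add0r ?addr0.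
  have [-> | xa] := eqVneq x a.
    rewrite (negPf ab) -[X in X == _]addr0 (inj_eq (addrI a)) eq_sym (negPf b0).
    by rewrite ?add0r ?addr0.
  have [-> | xb] := eqVneq x b.
    rewrite addrC -[X in X == _]addr0 (inj_eq (addrI b)) eq_sym (negPf a0).
    by rewrite ?add0r ?addr0.
  by case: eqP; rewrite !addr0.
have hx x : dot x p = (x \notin V)%:R.
  have := h x; have := h 0; rewrite !DDE dot0l mem_head add0r => <-.
  case: (x \in V); first by move/addIr; rewrite -[RHS]add0r => /addIr.
  by rewrite addr0 addrC => /addrI.
have [u uV] : exists u, u \notin V by apply: exists_notin.
have [w] : exists w, w \notin V ++ [seq u + v | v <- V].
  exact: exists_notin.
rewrite mem_cat negb_or => /andP [wV wuV].
have uwV : u + w \notin V.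
  apply: contra wuV => h1; apply/mapP; exists (u + w) => //.
  by rewrite addrA addrr2 add0r.
by have := hx (u + w); rewrite dotDl !hx uV wV uwV addF2.
Qed.

Lemma free_pair_in n (U : {vspace 'rV['F_2]_n}) : (1 < \dim U)%N ->
  exists a b, [/\ a \in U, b \in U & free [:: a; b]].
Proof.
move=> hU; have := basis_free (vbasisP U); have := size_tuple (vbasis U).
have inU v : v \in tval (vbasis U) -> v \in U by exact: vbasis_mem.
move: (tval (vbasis U)) inU => [|a [|b s]] /= inU.
- by move=> h0; rewrite -h0 in hU.
- by move=> h0; rewrite -h0 in hU.
move=> _ hf; exists a, b; split; [apply: inU | apply: inU |].
- by rewrite !inE eqxx.
- by rewrite !inE eqxx ?orbT.
- by have := @catl_free _ _ s [:: a; b] hf.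
Qed.

(** * Indices *)

Lemma M_subspace_relaxed n (g : 'rV['F_2]_n -> 'F_2) U :
  M_subspace g U -> relaxed_M_subspace g U.
Proof.
move=> /forallP h; apply/forallP => a; apply/forallP => b.
have /forallP /(_ b) := h a; case: (a \in U); case: (b \in U) => //= h0.
by apply/existsP; exists 0.
Qed.

Lemma ind_le_r_ind n (g : 'rV['F_2]_n -> 'F_2) : (ind g <= r_ind g)%N.
Proof.
apply/bigmax_leqP => X hX.
by apply: (bigmax_sup X) => //; apply: M_subspace_relaxed.
Qed.

(** Lines are M-subspaces of every function. *)
Lemma ind_gt0 n (g : 'rV['F_2]_n -> 'F_2) : (0 < n)%N -> (0 < ind g)%N.
Proof.
case: n g => // n g _; pose e : 'rV['F_2]_n.+1 := delta_mx 0 0.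
have e0 : e != 0.
  by apply/eqP => /matrixP /(_ 0 0); rewrite !mxE !eqxx => /eqP;
    rewrite oner_eq0.
have sp : <<[tuple of nseq n.+1 e]>>%VS = <[e]>%VS.
  apply: subv_anti; apply/andP; split.
    apply/span_subvP => v; rewrite mem_nseq => /eqP ->; exact: memv_line.
  by rewrite -memvE memv_span // mem_nseq eqxx.
have hM : M_subspace g <<[tuple of nseq n.+1 e]>>%VS.
  rewrite sp; apply/forallP => a; apply/forallP => b.
  apply/implyP => ha; apply/implyP => hb; apply/forallP => x.
  rewrite derive2_dependent // free2_F2.
  case/vlineP: ha => k ->; case/vlineP: hb => l ->.
  by case: (F2_cases k) => ->; case: (F2_cases l) => ->;
    rewrite ?scale0r ?scale1r ?eqxx ?andbF.
by apply: (bigmax_sup [tuple of nseq n.+1 e]) => //; rewrite sp dim_vline e0.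
Qed.

(** * Characters *)

Definition chi (c : 'F_2) : int := (-1) ^+ nat_of_ord c.

Lemma chiD c d : chi (c + d) = chi c * chi d.
Proof. by case: (F2_cases c) => ->; case: (F2_cases d) => ->. Qed.

Lemma chi_sqr c : chi c = 1 \/ chi c = -1.
Proof. by case: (F2_cases c) => ->; [left | right]. Qed.

Lemma sum_chi_dot m (w : 'rV['F_2]_m) :
  \sum_x chi (dot w x) = if w == 0 then 2 ^+ m else 0.
Proof.
have [-> | w0] := eqVneq w 0.
  under eq_bigr => x _ do rewrite dot0l.
  by rewrite sumr_const card_mx card_Fp // mul1n [chi 0]/= -natrX.
have [v hv] : exists v, dot w v = 1.
  case: (pickP (fun v => dot w v != 0)) => [v hv | h].
    by exists v; case: (F2_cases (dot w v)) hv => -> //; rewrite eqxx.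
  case/eqP: w0; apply: dot_nondeg => v; apply/eqP.
  by rewrite -[_ == _]negbK h.
set S := \sum_x _.
have : S = - S.
  rewrite {1}/S (reindex_inj (addIr v)) /= -sumrN; apply: eq_bigr => x _.
  by rewrite dotDr hv chiD mulrN1.
lia.
Qed.

Lemma sum_row_mx m (V : nmodType) (F : 'rV['F_2]_(m + m) -> V) :
  \sum_z F z = \sum_x \sum_y F (row_mx x y).
Proof.
rewrite pair_big /=.
rewrite (reindex (fun p : 'rV['F_2]_m * 'rV['F_2]_m => row_mx p.1 p.2)) //=.
exists (fun z => (lsubmx z, rsubmx z)) => [[x y] _ | z _] /=.
  by rewrite row_mxKl row_mxKr.
by rewrite hsubmxK.
Qed.

(** * The functions x.P(y) + delta_0(x) *)

Section SpikedMM.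

Variables (m : nat) (P : 'rV['F_2]_m -> 'rV['F_2]_m).
Variable f : 'rV['F_2]_(m + m) -> 'F_2.
Hypothesis fE : forall z,
  f z = dot (lsubmx z) (P (rsubmx z)) + delta0 (lsubmx z).

Lemma fE_row x y : f (row_mx x y) = dot x (P y) + delta0 x.
Proof. by rewrite fE row_mxKl row_mxKr. Qed.

Lemma bent_spiked : injective P -> bent f.
Proof.
move=> injP; split; first by rewrite addnn odd_double.
move=> u W; set u1 := lsubmx u; set u2 := rsubmx u.
have -> : (m + m)./2 = m by rewrite addnn doubleK.
(* (-1)^(delta0 x) is 1 for x != 0 and -1 for x = 0, which subtracts twice the
   terms with x = 0. *)
have -> : W =
    \sum_y chi (dot u2 y) * (\sum_x chi (dot (P y + u1) x))
      - 2 * \sum_y chi (dot u2 y).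
  transitivity (\sum_x \sum_y chi (dot u2 y) * chi (dot (P y + u1) x)
      - 2 * \sum_y chi (dot u2 y)).
    rewrite {}/W -[LHS]/(\sum_z chi (f z + dot u z)) sum_row_mx.
    rewrite [in LHS](bigD1 0) // [in RHS](bigD1 0) //.
    rewrite -addrA [X in _ = _ + X]addrC addrA; congr (_ + _).
      rewrite mulr_sumr -sumrB; apply: eq_bigr => y _.
      rewrite fE_row dot_row_mx row_mxKl row_mxKr -/u1 -/u2.
      rewrite delta0E eqxx !dot0l !dot0r !add0r chiD.
      by rewrite -[chi true%:R]/(-1) -[chi 0]/1; ring.
    apply: eq_bigr => x x0; apply: eq_bigr => y _.
    rewrite fE_row dot_row_mx row_mxKl row_mxKr -/u1 -/u2.
    rewrite delta0E (negPf x0) addr0 addrA chiD mulrC; congr (_ * chi _).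
    by rewrite dotDl; congr (_ + _); exact: dotC.
  rewrite exchange_big; congr (_ - _).
  by apply: eq_bigr => y _; rewrite mulr_sumr.
have [Q QK PK] := injF_bij injP.
rewrite (bigD1 (Q u1)) //= [X in _ + X - _]big1 ?addr0; last first.
  move=> y hy; rewrite sum_chi_dot addr2_eq0.
  case: eqP => [h | _]; last by rewrite mulr0.
  by case/eqP: hy; rewrite -h QK.
rewrite sum_chi_dot addr2_eq0 PK eqxx sum_chi_dot.
have [-> | _] := eqVneq u2 0; first by right; rewrite dot0l [chi 0]/=; ring.
by case: (chi_sqr (dot u2 (Q u1))) => ->; [left | right]; ring.
Qed.

Hypotheses (hm : (4 <= m)%N) (P1 : property_P1 P).

Lemma derive2_spiked (a1 a2 b1 b2 x y : 'rV['F_2]_m) :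
  derive (row_mx a1 a2) (derive (row_mx b1 b2) f) (row_mx x y) =
    dot x (derive a2 (derive b2 P) y)
    + (dot (a1 + b1) (P (y + a2 + b2)) + dot a1 (P (y + a2))
       + dot b1 (P (y + b2)))
    + derive a1 (derive b1 (@delta0 m)) x.
Proof.
rewrite /derive !add_row_mx !fE_row !dotDl !dotDr; ring.
Qed.

(** All directions along which the second derivative of f can be constant reduce
    to one shape: a plane generated by some (a1,0) and some (0,b2). *)
Lemma constant_derive2_spiked (a b : 'rV['F_2]_(m + m)) (c : 'F_2) :
    free [:: a; b] -> (forall z, derive a (derive b f) z = c) ->
  exists a1 b2 : 'rV['F_2]_m,
    [/\ a1 != 0, b2 != 0 & forall y, dot a1 (derive b2 P y) = c].
Proof.
move=> fab habc.
have h x y : dot x (derive (rsubmx a) (derive (rsubmx b) P) y)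
    + (dot (lsubmx a + lsubmx b) (P (y + rsubmx a + rsubmx b))
       + dot (lsubmx a) (P (y + rsubmx a)) + dot (lsubmx b) (P (y + rsubmx b)))
    + derive (lsubmx a) (derive (lsubmx b) (@delta0 m)) x = c.
  by rewrite -derive2_spiked !hsubmxK.
have nfl : ~~ free [:: lsubmx a; lsubmx b].
  apply/negP; rewrite free2_F2 => /and3P [a0 b0 ab].
  apply: (two_flat_indicator_not_affine hm a0 b0 ab) => x.
  exact: (h x 0).
have nfr : ~~ free [:: rsubmx a; rsubmx b].
  apply/negP => /P1; apply=> y; apply: dot_nondeg => x; rewrite dotC.
  have := h x y; rewrite -[RHS](h 0 y).
  by rewrite !(derive2_dependent _ _ nfl) !addr0 dot0l => /addIr.
(* Two vectors with dependent images under a linear map g span a plane which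
   meets the kernel of g outside 0. *)
have pick (g : 'rV['F_2]_(m + m) -> 'rV['F_2]_m) : {morph g : x y / x + y} ->
    ~~ free [:: g a; g b] -> exists2 u, u \in [:: a; b; a + b] & g u = 0.
  move=> gD; rewrite free2_F2 !negb_and !negbK => /or3P [] /eqP g0.
  - by exists a; rewrite ?mem_head.
  - by exists b; rewrite ?inE ?eqxx ?orbT.
  - by exists (a + b); rewrite ?inE ?eqxx ?orbT // gD g0 addrr2.
have [u uab ru0] := pick _ (fun x y => linearD _ x y) nfl.
have [w wab lw0] := pick _ (fun x y => linearD _ x y) nfr.
have nz v : v \in [:: a; b; a + b] -> v != 0.
  move: fab; rewrite free2_F2 => /and3P [a0 b0 ab].
  by rewrite !inE => /or3P [] /eqP -> //; rewrite addr2_eq0.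
have w1 : lsubmx w != 0.
  by apply: contra (nz _ wab) => /eqP h0; rewrite -[w]hsubmxK h0 lw0 row_mx0.
have u2 : rsubmx u != 0.
  by apply: contra (nz _ uab) => /eqP h0; rewrite -[u]hsubmxK h0 ru0 row_mx0.
have wu : w != u by apply: contra w1 => /eqP ->; rewrite ru0.
exists (lsubmx w), (rsubmx u); split=> // y.
rewrite -(habc (row_mx 0 y)) -(derive2_span f _ wab uab wu).
rewrite -[in RHS](hsubmxK w) -[in RHS](hsubmxK u) ru0 lw0 derive2_spiked.
rewrite derive2_dependent ?free2_F2 ?eqxx ?andbF // !dot0l !addr0 add0r.
by rewrite dotDr.
Qed.

(** For x.s(y) + h(y) all second derivatives along the vectors (x,0) vanish; a
    plane of such vectors, transported by the affine equivalence, would be a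
    plane along which those of f vanish. *)
Lemma not_class_MM_sharp_spiked :
    (forall a1 b2 : 'rV['F_2]_m, a1 != 0 -> b2 != 0 ->
      ~ (forall y, dot a1 (derive b2 P y) = 0)) ->
  ~ class_MM_sharp f.
Proof.
move=> hP [g [[s [h gE]] [A [c [u [e [uA fg]]]]]]].
have [v v0] : exists v, v \notin [:: (0 : 'rV['F_2]_m)] by apply: exists_notin.
have [w wv] : exists w, w \notin [:: 0; v] by apply: exists_notin.
pose L (x : 'rV['F_2]_m) := row_mx x (0 : 'rV['F_2]_m) *m invmx A.
have LA x z : (z + L x) *m A + c = z *m A + c + row_mx x 0.
  by rewrite mulmxDl mulmxKV // addrAC.
have Linj : injective L.
  by move=> x x' /(can_inj (mulmxKV uA)) /eq_row_mx [].
have L0 : L 0 = 0 by rewrite /L row_mx0 mul0mx.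
have fLvw : free [:: L v; L w].
  rewrite free2_F2 -L0 !(inj_eq Linj).
  by move: v0 wv; rewrite !inE negb_or (eq_sym v w) => -> /andP [-> ->].
have [|a1 [b2 [a0 b0 h0]]] := constant_derive2_spiked (c := 0) fLvw.
  move=> z; rewrite derive2E !fg !LA !gE.
  move: (z *m A + c) => t; rewrite -[t]hsubmxK !add_row_mx !addr0.
  rewrite !row_mxKl !row_mxKr !dotDl !dotDr.
  move: (dot _ _) (dot v _) (dot w _) (h _) (dot u z) (dot u (L v)).
  move: (dot u (L w)) => x7.
  move=> x1 x2 x3 x4 x5 x6.
  (* Every term occurs an even number of times. *)
  transitivity ((x1 + x2 + x3 + x4 + x5 + x6 + x7 + x1 + x4 + x5 + e + e) *+ 2).
    ring.
  by rewrite mulr2n addF2.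
exact: hP a0 b0 h0.
Qed.

Lemma r_ind_spiked_le1 :
    (forall a1 b2 : 'rV['F_2]_m, a1 != 0 -> b2 != 0 -> forall c,
      ~ (forall y, dot a1 (derive b2 P y) = c)) ->
  (r_ind f <= 1)%N.
Proof.
move=> hP; apply/bigmax_leqP => X /forallP hX; rewrite leqNgt; apply/negP.
move=> /free_pair_in [a [b [aX bX fab]]].
move: (hX a) => /forallP /(_ b); rewrite aX bX => /existsP [c /forallP hc].
have [|a1 [b2 [a0 b0 h]]] := constant_derive2_spiked (c := c) fab.
  by move=> z; apply/eqP.
exact: hP a0 b0 c h.
Qed.

Lemma ind_spiked_le1 :
    (forall a1 b2 : 'rV['F_2]_m, a1 != 0 -> b2 != 0 ->
      ~ (forall y, dot a1 (derive b2 P y) = 0)) ->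
  (ind f <= 1)%N.
Proof.
move=> hP; apply/bigmax_leqP => X /forallP hX; rewrite leqNgt; apply/negP.
move=> /free_pair_in [a [b [aX bX fab]]].
move: (hX a) => /forallP /(_ b); rewrite aX bX => /forallP hc.
have [|a1 [b2 [a0 b0 h]]] := constant_derive2_spiked (c := 0) fab.
  by move=> z; apply/eqP.
exact: hP a0 b0 h.
Qed.

End SpikedMM.

Lemma spiked_MM_conclusion m (hm : (4 <= m)%N) (P : 'rV['F_2]_m -> 'rV['F_2]_m)
    (f : 'rV['F_2]_(m + m) -> 'F_2) :
    injective P -> property_P1 P ->
    (forall z, f z = dot (lsubmx z) (P (rsubmx z)) + delta0 (lsubmx z)) ->
    (forall a1 b2 : 'rV['F_2]_m, a1 != 0 -> b2 != 0 ->
      ~ (forall y, dot a1 (derive b2 P y) = 0)) ->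
  [/\ bent f, ~ class_MM_sharp f, l_optimal f
    & (forall a1 b2 : 'rV['F_2]_m, a1 != 0 -> b2 != 0 ->
         ~ (forall y, dot a1 (derive b2 P y) = 1)) -> r_ind f = 1%N].
Proof.
move=> injP P1 fE P0.
have i0 : (0 < ind f)%N by apply: ind_gt0; lia.
have bf := bent_spiked fE injP.
split=> //; first exact: (not_class_MM_sharp_spiked fE hm P1).
  by split=> //; apply/eqP; rewrite eqn_leq i0 (ind_spiked_le1 fE hm P1).
move=> P1'; apply/eqP; rewrite eqn_leq (leq_trans i0 (ind_le_r_ind f)) andbT.
apply: (r_ind_spiked_le1 fE hm P1) => a1 b2 a0 b0 c.
by case: (F2_cases c) => ->; [apply: P0 | apply: P1'].
Qed.

(** * Weighted families of sets with vanishing covering sums *)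

Section Isolation.

Variables (V : zmodType) (K I : finType) (S : K -> {set I}) (c : K -> V).
Variable r : nat.
Hypotheses (injS : injective S) (c_neq0 : forall k, c k != 0).
Hypothesis cover0 : forall N : {set I},
  N != set0 -> (#|N| <= r)%N -> \sum_(k | N \subset S k) c k = 0.

Definition matches (A B : seq I) (k : K) : bool :=
  all (mem (S k)) A && all [predC S k] B.

(** Inclusion-exclusion, one excluded point at a time. *)
Lemma sum_matches (A B : seq I) :
    A != [::] -> (size A + size B <= r)%N -> \sum_(k | matches A B k) c k = 0.
Proof.
elim: B A => [|j B IHB] A A0 szAB.
  apply: etrans (cover0 (N := [set x in A]) _ _).
  - apply: eq_bigl => k; rewrite /matches andbT.
    by apply/allP/subsetP => h x; have := h x; rewrite inE.
  - by case: A A0 {szAB} => // x A _; apply/set0Pn; exists x; rewrite !inE eqxx.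
  - by rewrite cardsE (leq_trans (card_size A)) //
      (leq_trans (leq_addr _ _) szAB).
have := IHB A A0; rewrite (bigID (fun k => j \in S k)) /=.
rewrite (eq_bigl (matches (j :: A) B)); last first.
  by move=> k; rewrite /matches /= andbC andbA.
rewrite IHB /= ?add0r => [h||]; first last.
- by move: szAB => /=; lia.
- by [].
rewrite -[RHS]h; last by move: szAB => /=; lia.
by apply: eq_bigl => k; rewrite /matches /=; case: (j \in S k);
  rewrite ?andbF ?andbT.
Qed.

Lemma matches_not_single (A B : seq I) :
    A != [::] -> (size A + size B <= r)%N -> #|[set k | matches A B k]| != 1%N.
Proof.
move=> A0 szAB; apply/negP => /cards1P [k Kk].
have := sum_matches A0 szAB; under eq_bigl do rewrite -[matches _ _ _]inE.
rewrite (eq_bigl (mem [set k])) ?big_set1 => [/eqP|l];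
  by rewrite -?Kk ?inE ?(negPf (c_neq0 k)).
Qed.

(** A point on which two selected sets disagree splits the selection into two
    nonempty parts.  The smaller part has at most half of the elements, so that
    s splittings reach a single set, contrary to [matches_not_single]. *)
Lemma no_few_matches (s : nat) (A B : seq I) :
    A != [::] -> (size A + size B + s <= r)%N ->
  ~~ (0 < #|[set k | matches A B k]| < 2 ^ s.+1)%N.
Proof.
elim: s A B => [|s IHs] A B A0 szAB; apply/negP => /andP [K_gt0 K_lt].
  by have := @matches_not_single A B A0; rewrite expn1 in K_lt; lia.
have K_neq1 : #|[set k | matches A B k]| != 1%N.
  by apply: matches_not_single => //; lia.
have /card_gt1P [k [l [Kk Kl kl]]] : (1 < #|[set k | matches A B k]|)%N by lia.
have [j jkl] : exists j, (j \in S k) != (j \in S l).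
  apply/existsP; apply: contraT; rewrite negb_exists => /forallP h.
  case/eqP: kl; apply: injS; apply/setP => j; apply/eqP.
  by have := h j; rewrite negbK.
have splitK : #|[set k | matches A B k]| =
    (#|[set k | matches (j :: A) B k]| + #|[set k | matches A (j :: B) k]|)%N.
  rewrite -(cardsID [set k | j \in S k]); congr (_ + _)%N; apply: eq_card => x;
    rewrite !inE /matches /=; by case: (j \in S x); rewrite ?andbF ?andbT.
have IH1 := IHs (j :: A) B isT; have IH2 := IHs A (j :: B) A0.
have gt0 : ((0 < #|[set k | matches (j :: A) B k]|) &&
    (0 < #|[set k | matches A (j :: B) k]|))%N.
  rewrite !card_gt0; apply/andP; split; apply/set0Pn.
    by exists (if j \in S k then k else l);
      move: Kk Kl jkl; rewrite !inE /matches /=;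
      case: ifP => [->|_]; [|case: (j \in S l)] => //.
  by exists (if j \in S k then l else k);
    move: Kk Kl jkl; rewrite !inE /matches /=;
    case: ifP => [_|->]; [case: (j \in S l)|] => //.
case/andP: gt0 => g1 g2; move: IH1 IH2; rewrite g1 g2 /= -!leqNgt.
move: szAB K_lt => /=; rewrite splitK (expnS 2 s.+1) => szAB K_lt IH1 IH2.
have := IH1 _; have := IH2 _; lia.
Qed.

Lemma no_isolation (i : I) :
  ~~ (0 < #|[set k | i \in S k]| < 2 ^ r)%N.
Proof.
case: r cover0 (@no_few_matches r.-1 [:: i] [::] isT) => [|r' _]; first by lia.
rewrite /= add1n => /(_ (leqnn _)).
suff -> : [set k | matches [:: i] [::] k] = [set k | i \in S k] by [].
by apply/setP => k; rewrite !inE /matches /= !andbT.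
Qed.

End Isolation.

(** * Binary digits *)

Definition binval m (J : {set 'I_m}) : nat := \sum_(i in J) 2 ^ i.

Definition bits m (e : nat) : {set 'I_m} := [set i : 'I_m | odd (e %/ 2 ^ i)].

Lemma bitsK m e : (e < 2 ^ m)%N -> binval (bits m e) = e.
Proof.
rewrite /binval; under eq_bigl do rewrite inE.
elim: m e => [|m IHm] e he; first by rewrite big_ord0; case: e he.
rewrite big_mkcond big_ord_recl /= expn0 divn1.
rewrite (eq_bigr (fun i : 'I_m =>
  2 * (if odd (e %/ 2 %/ 2 ^ i) then 2 ^ i else 0)))%N.
  rewrite -big_distrr /= -big_mkcond IHm.
    by rewrite [in RHS](divn_eq e 2) modn2; case: (odd e); lia.
  by rewrite ltn_divLR // mulnC -expnS.
by move=> i _; rewrite -divnMA -expnS; case: ifP => _; rewrite ?expnS ?muln0.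
Qed.

Lemma binval_lt m (J : {set 'I_m}) : (binval J < 2 ^ m)%N.
Proof.
have h : (\sum_(i < m) 2 ^ i < 2 ^ m)%N.
  by elim: m {J} => [|m IHm]; rewrite ?big_ord0 //
    big_ord_recr expnS mul2n -addnn /= ltn_add2r.
apply: leq_ltn_trans h; rewrite /binval [leqRHS](bigID (mem J)) /=.
exact: leq_addr.
Qed.

(** [bits] is injective between two sets with 2^m elements, hence onto. *)
Lemma binval_inj m : injective (@binval m).
Proof.
have bi : injective (fun e : 'I_(2 ^ m) => bits m e).
  by move=> e e' /(congr1 (@binval m)); rewrite !bitsK // => /val_inj.
have [|g _ Kg] := inj_card_bij bi.
  by rewrite card_ord -cardsT -powersetT card_powerset cardsT card_ord.
move=> J J' h; rewrite -[J]Kg -[J']Kg; congr (bits _ _); move: h.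
by rewrite -{1}[J]Kg -{1}[J']Kg !bitsK.
Qed.

(** * Conjugate monomials over the field with 2^m elements *)

Section BinaryField.

Variables (n : nat) (L : fieldExtType 'F_2).
Variable psi : {linear 'rV['F_2]_n.+1 -> L}.
(* The bijection with the row vectors says that L has 2^(n+1) elements. *)
Hypothesis bij_psi : bijective psi.
Let m := n.+1.
Implicit Types (z t b lambda : L) (J D : {set 'I_m}).

Lemma sum_delta (K : finType) (k : K) (F : K -> L) :
  \sum_i (i == k)%:R * F i = F k.
Proof.
under eq_bigr do rewrite mulr_natl mulrb.
by rewrite -big_mkcond big_pred1_eq.
Qed.

Lemma addL2 z : z + z = 0.
Proof.
apply: addrr_pchar2; rewrite pchar_lalg; exact: pchar_Fp.
Qed.

Lemma addL2_eq0 z t : (z + t == 0) = (z == t).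
Proof. by rewrite addr_eq0 -[- t]addr0 -(addL2 t) addKr. Qed.

Lemma frobD k z t : (z + t) ^+ (2 ^ k) = z ^+ (2 ^ k) + t ^+ (2 ^ k).
Proof.
apply: exprDn_pchar; rewrite pnatX; apply/orP; left.
rewrite pnatE // pchar_lalg; exact: pchar_Fp.
Qed.

Lemma frob_sum k (K : finType) (A : pred K) (F : K -> L) :
  (\sum_(i | A i) F i) ^+ (2 ^ k) = \sum_(i | A i) F i ^+ (2 ^ k).
Proof.
apply: (big_morph (fun z => z ^+ (2 ^ k)) (frobD k)).
by rewrite expr0n expn_eq0.
Qed.

Lemma frob_period z : z ^+ (2 ^ m) = z.
Proof.
have cL : #|finvect_type L| = (2 ^ m)%N.
  rewrite -(bij_eq_card (f := psi : _ -> finvect_type L)) // card_mx card_Fp //.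
  by rewrite mul1n.
by rewrite -cL; exact: (@expf_card (finvect_type L) z).
Qed.

Lemma frob_mod k z : z ^+ (2 ^ (k %% m)) = z ^+ (2 ^ k).
Proof.
rewrite [in RHS](divn_eq k m) expnD exprM; congr (_ ^+ _).
elim: (k %/ m)%N => [|j IHj]; first by rewrite mul0n expr1.
by rewrite mulSn expnD exprM frob_period.
Qed.

Definition conj_monomial J t : L := \prod_(i in J) t ^+ (2 ^ i).

Lemma conj_monomialE J t : conj_monomial J t = t ^+ binval J.
Proof. by rewrite /conj_monomial prodrXr. Qed.

(** Distinct sets give distinct exponents below 2^m, so a linear relation is a
    polynomial of degree less than 2^m with 2^m roots. *)
Lemma conj_monomial_free (a : {set 'I_m} -> L) :
  (forall t, \sum_J a J * conj_monomial J t = 0) -> forall J, a J = 0.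
Proof.
move=> h J; pose p := \sum_J (a J)%:P * 'X^(binval J).
have coefp K : p`_(binval K) = a K.
  rewrite coef_sum (bigD1 K) //= coefCM coefXn eqxx mulr1 big1 ?addr0 //.
  move=> J' J'K.
  by rewrite coefCM coefXn (inj_eq (@binval_inj _)) eq_sym (negPf J'K) mulr0.
rewrite -coefp; suff -> : p = 0 by rewrite coef0.
apply/eqP; apply: contraT => p0.
have := @max_poly_roots _ p [seq psi y | y <- enum 'rV['F_2]_m] p0.
rewrite map_inj_uniq ?enum_uniq; last exact: bij_inj.
rewrite size_map -cardE card_mx card_Fp // mul1n => /(_ _ isT) h1.
have: (2 ^ m < size p)%N.
  apply: h1; apply/allP => z _; rewrite /root horner_sum; apply/eqP.
  rewrite -[RHS](h z); apply: eq_bigr => K _.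
  by rewrite hornerCM hornerXn conj_monomialE.
rewrite ltnNge => /negP []; apply: leq_trans (size_sum _ _ _) _.
apply/bigmax_leqP => K _; rewrite mul_polyC.
by apply: leq_trans (size_scale_leq _ _) _; rewrite size_polyXn binval_lt.
Qed.

Lemma frob_free (a : 'I_m -> L) :
  (forall t, \sum_i a i * t ^+ (2 ^ i) = 0) -> forall i, a i = 0.
Proof.
move=> h i.
have := @conj_monomial_free (fun J => \sum_(i | [set i] == J) a i) _ [set i].
rewrite (big_pred1 i) => [|j]; last by rewrite /= (inj_eq set1_inj).
apply=> t; rewrite -[RHS](h t).
under eq_bigr do rewrite mulr_suml.
rewrite (exchange_big_dep xpredT) //=; apply: eq_bigr => j _.
rewrite (big_pred1 [set j]) => [|J]; last by rewrite /= eq_sym.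
by rewrite /conj_monomial big_set1.
Qed.

(** The exponent is first reduced modulo 2^m - 1, with representatives in
    1, ..., 2^m - 1 rather than 0, ..., 2^m - 2 so that the formula also holds
    at z = 0. *)
Lemma exp_conj_monomial d : (0 < d)%N ->
  exists D, forall z, z ^+ d = conj_monomial D z.
Proof.
case: d => // d _; pose q := (2 ^ m).-1.
have qE : (2 ^ m)%N = q.+1 by rewrite prednK // expn_gt0.
have q0 : (0 < q)%N by have := ltn_expl m (isT : (1 < 2)%N); rewrite qE /m; lia.
exists (bits m (d %% q).+1) => z.
rewrite conj_monomialE bitsK ?qE ?ltnS ?ltn_mod //.
have [-> | z0] := eqVneq z 0; first by rewrite !expr0n.
have zq : z ^+ q = 1.
  by apply: (mulIf z0); rewrite mul1r -exprSr -qE frob_period.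
by rewrite {1}(divn_eq d q) !exprSr exprD mulnC exprM zq expr1n mul1r.
Qed.

Definition shift k D : {set 'I_m} := [set i | i - k \in D].

Lemma card_shift k D : #|shift k D| = #|D|.
Proof.
rewrite -[RHS](card_imset _ (addIr k)); congr #|pred_of_set _|.
apply/setP => i; rewrite inE; apply/idP/imsetP => [h | [j jD ->]].
  by exists (i - k); rewrite ?subrK.
by rewrite addrK.
Qed.

Lemma conj_monomial_frob (k : 'I_m) D t :
  conj_monomial D t ^+ (2 ^ k) = conj_monomial (shift k D) t.
Proof.
rewrite /conj_monomial -prodrXl [RHS](reindex_inj (addIr k)) /=.
apply: eq_big => [i | i _]; first by rewrite inE addrK.
by rewrite -exprM -expnD frob_mod.
Qed.

Lemma conj_monomialM D z t :
  conj_monomial D (z * t) = conj_monomial D z * conj_monomial D t.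
Proof.
by rewrite /conj_monomial -big_split; apply: eq_bigr => i _; rewrite exprMn.
Qed.

Lemma conj_monomial_neq0 D z : z != 0 -> conj_monomial D z != 0.
Proof. by move=> z0; apply/prodf_neq0 => i _; rewrite expf_neq0. Qed.

Lemma conj_monomial_add1 D t :
  conj_monomial D (t + 1) =
    \sum_(J : {set 'I_m} | J \subset D) conj_monomial J t.
Proof.
transitivity (\prod_i ((if i \in D then t ^+ (2 ^ i) else 0) + 1)).
  rewrite /conj_monomial big_mkcond; apply: eq_bigr => i _.
  by case: ifP => _; rewrite ?add0r // frobD expr1n.
rewrite bigA_distr [RHS]big_mkcond; apply: eq_bigr => J _.
case: ifP => [/subsetP JD | /negbT /subsetPn [i iJ iD]].
  rewrite /conj_monomial [RHS]big_mkcond; apply: eq_bigr => i _.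
  by case: ifP => // /JD ->.
by rewrite (bigD1 i) //= iJ (negPf iD) mul0r.
Qed.

Lemma derive_conj_monomial D t :
  conj_monomial D (t + 1) + conj_monomial D t =
    \sum_(J : {set 'I_m} | J \proper D) conj_monomial J t.
Proof.
rewrite conj_monomial_add1 (bigD1 D) //= addrAC addL2 add0r.
by apply: eq_bigl => J; rewrite properEneq andbC.
Qed.

(** The absolute trace, with values in L instead of the prime field. *)
Definition ftrace z : L := \sum_(i < m) z ^+ (2 ^ i).

Lemma ftraceD z t : ftrace (z + t) = ftrace z + ftrace t.
Proof. by rewrite /ftrace -big_split; apply: eq_bigr => i _; rewrite frobD. Qed.

Lemma ftrace_F2 z : ftrace z = 0 \/ ftrace z = 1.
Proof.
have : ftrace z ^+ 2 = ftrace z.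
  rewrite -[2%N]/(2 ^ 1)%N frob_sum [RHS]big_ord_recl [LHS]big_ord_recr /=.
  rewrite -exprM -expnD addn1 -/m frob_period addrC expr1; congr (_ + _).
  by apply: eq_bigr => i _; rewrite -exprM -expnD addn1.
move/eqP; rewrite expr2 -{3}[ftrace z]mulr1 -subr_eq0 -mulrBr mulf_eq0 subr_eq0.
by case/orP => /eqP; [left | right].
Qed.

Lemma abs_traceE z : (abs_trace m z)%:A = ftrace z.
Proof.
rewrite /abs_trace; case: pickP => [t /eqP -> // | h].
by case: (ftrace_F2 z) => hz; [have := h 0 | have := h 1];
  rewrite -/(ftrace z) hz ?scale0r ?scale1r eqxx.
Qed.

Lemma ftrace_nondeg lambda : (forall t, ftrace (lambda * t) = 0) -> lambda = 0.
Proof.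
move=> h; apply/eqP; apply: contraT => l0.
suff: lambda ^+ (2 ^ (ord0 : 'I_m)) = 0 by move/eqP; rewrite expr1 (negPf l0).
apply: (frob_free (a := fun i => lambda ^+ (2 ^ i))).
by move=> t; rewrite -[RHS](h t); apply: eq_bigr => i _; rewrite exprMn.
Qed.

(** The weights of the cyclic shifts of D are nonzero and have vanishing covering
    sums up to size w - 1, so [no_isolation] applies to the w shifts containing
    0.  It needs w < 2^(w-1), that is, w > 2; a quadratic monomial can have a
    trace with constant derivatives. *)
Lemma trace_derive_monomial_nonconstant D lambda b c :
    injective (conj_monomial D) -> (2 < #|D|)%N -> lambda != 0 -> b != 0 ->
  ~ (forall z,
      ftrace (lambda * (conj_monomial D (z + b) + conj_monomial D z)) = c).
Proof.
move=> injD D3 l0 b0 h; set w := #|D| in D3.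
pose e (k : 'I_m) := (lambda * conj_monomial D b) ^+ (2 ^ k).
have e0 k : e k != 0 by rewrite expf_neq0 // mulf_neq0 // conj_monomial_neq0.
have he t : \sum_k e k *
    \sum_(J : {set 'I_m} | J \proper shift k D) conj_monomial J t = c.
  rewrite -(h (b * t)); apply: eq_bigr => k _.
  rewrite -derive_conj_monomial -!conj_monomial_frob -frobD -exprMn.
  congr (_ ^+ _).
  have -> : b * t + b = b * (t + 1) by rewrite mulrDr mulr1.
  by rewrite !conj_monomialM; ring.
have inj_shift : injective (shift^~ D).
  move=> k l kl.
  have kl' t : t ^+ (2 ^ k) = t ^+ (2 ^ l).
    apply: injD; rewrite /conj_monomial.
    transitivity (conj_monomial (shift k D) t); last rewrite kl;
      rewrite -conj_monomial_frob /conj_monomial -prodrXl;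
      by apply: eq_bigr => i _; rewrite -!exprM mulnC.
  apply/eqP; apply: contraT => /negPf kl0.
  suff: (1 : L) == 0 by rewrite oner_eq0.
  have <- : (k == k)%:R - (k == l)%:R = 1 :> L by rewrite eqxx kl0 subr0.
  apply/eqP; apply: (frob_free (a := fun i => (i == k)%:R - (i == l)%:R)) => t.
  under eq_bigr do rewrite mulrBl.
  by rewrite sumrB !sum_delta kl' subrr.
(* The coefficient of z^N, for N smaller than all shifts of D, so that being a
   proper subset of a shift is the same as being a subset. *)
have cover N : N != set0 -> (#|N| <= w.-1)%N ->
    \sum_(k | N \subset shift k D) e k = 0.
  move=> N0 Nw.
  have := @conj_monomial_free
    (fun J => \sum_(k | J \proper shift k D) e k - c *+ (J == set0)) _ N.
  rewrite (negPf N0) mulr0n subr0 => h0; rewrite -[RHS]h0.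
    apply: eq_bigl => k; rewrite properEneq andb_idl // => _.
    by apply: contraTneq Nw => ->; rewrite card_shift -ltnNge /w; lia.
  move=> t; under eq_bigr do rewrite mulrBl mulr_suml.
  rewrite sumrB (exchange_big_dep xpredT) //=.
  under [X in _ - X]eq_bigr do rewrite -mulr_natr -mulrA.
  rewrite -[X in _ - X]mulr_sumr sum_delta /conj_monomial big_set0 mulr1.
  rewrite -[X in _ - X](he t).
  by apply/eqP; rewrite subr_eq0; apply/eqP; apply: eq_bigr => k _;
    rewrite mulr_sumr.
have := no_isolation inj_shift e0 cover 0.
have -> : [set k | 0 \in shift k D] = [set - i | i in D].
  apply/setP => k; rewrite !inE sub0r.
  by apply/idP/imsetP => [h1 | [i iD ->]];
    [exists (- k); rewrite ?opprK | rewrite opprK].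
rewrite (card_imset _ oppr_inj) -/w => /negP []; apply/andP; split; first by lia.
case: (w) D3 => [|[|[|v]]] // _.
by elim: v => // v; rewrite /= (expnS 2 v.+2); lia.
Qed.

End BinaryField.

(** * The algebraic degree of a monomial map *)

Lemma sum_toggle (V : zmodType) (I : finType) (A : {set I}) (r : I)
    (G : {set I} -> V) :
    (forall v : V, v + v = 0) -> r \in A ->
    (forall X, G (r |: X) = G (X :\ r)) ->
  \sum_(X : {set I} | X \subset A) G X = 0.
Proof.
move=> V2 rA Gr; rewrite (bigID (fun X : {set I} => r \in X)) /=.
rewrite (reindex_onto (fun X => r |: X) (fun X => X :\ r)) /=; last first.
  by move=> X /andP [_ rX]; rewrite setD1K.
rewrite -[RHS](V2 (\sum_(X : {set I} | (X \subset A) && (r \notin X)) G X)).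
congr (_ + _); apply: eq_big => [X | X].
  rewrite subUset sub1set rA setU11 andbT /=; congr (_ && _).
  apply/eqP/idP => [<- | rX]; first by rewrite setD11.
  by rewrite setU1K.
case/andP => _ /eqP XE; rewrite Gr; congr G; apply/setDidPl.
by rewrite disjoint_sym disjoints1 -XE setD11.
Qed.

Definition indicator m (X : {set 'I_m}) : 'rV['F_2]_m :=
  \sum_(p in X) delta_mx 0 p.

Lemma indicatorE m (X : {set 'I_m}) i : indicator X 0 i = (i \in X)%:R.
Proof.
rewrite /indicator summxE; under eq_bigr do rewrite mxE eqxx /= eq_sym.
rewrite big_mkcond (bigD1 i) //= eqxx big1 ?addr0; first by case: ifP.
by move=> j /negPf ->; case: ifP.
Qed.

Lemma prod_indicator m (J X : {set 'I_m}) :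
  \prod_(i in J) indicator X 0 i = (J \subset X)%:R.
Proof.
case: (boolP (J \subset X)) => [/subsetP JX | /subsetPn [i iJ iX]].
  by rewrite big1 // => i /JX iX; rewrite indicatorE iX.
by rewrite (bigD1 i) //= indicatorE (negPf iX) mul0r.
Qed.

(** Moebius inversion: the monomials indexed by J <> A cancel, because the value
    at X does not change when a point of A outside J is added to X. *)
Lemma anf_coef m (c : {ffun {set 'I_m} -> 'F_2}) (A : {set 'I_m}) :
  \sum_(X : {set 'I_m} | X \subset A) anf_eval c (indicator X) = c A.
Proof.
rewrite /anf_eval exchange_big (bigD1 A) //= [X in _ + X]big1 ?addr0.
  rewrite (bigD1 A) //= prod_indicator subxx mulr1 big1 ?addr0 //.
  move=> X /andP [XA XnA].
  by rewrite prod_indicator; case: eqP XnA XA => // nXA _ XA;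
    rewrite (_ : A \subset X = false) ?mulr0 //; apply/negP => AX; case: nXA;
    apply/eqP; rewrite eqEsubset XA.
move=> J JA; rewrite -mulr_sumr.
suff -> : \sum_(X : {set 'I_m} | X \subset A)
    \prod_(i in J) indicator X 0 i = 0.
  by rewrite mulr0.
have [AJ | /subsetPn [r rA rJ]] := boolP (A \subset J).
  apply: big1 => X XA; rewrite prod_indicator (_ : J \subset X = false) //.
  apply/negP => JX; case/eqP: JA; apply/eqP.
  by rewrite eqEsubset AJ (subset_trans JX XA).
apply: (sum_toggle addF2 rA) => X /=; apply: eq_bigr => i iJ.
have ir : i != r by apply: contraNneq rJ => <-.
by rewrite !indicatorE !inE ir (negPf ir).
Qed.

Lemma vec_degree_le m (F : 'rV['F_2]_m -> 'rV['F_2]_m) (w : nat) :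
    (forall A : {set 'I_m}, (w < #|A|)%N ->
      \sum_(X : {set 'I_m} | X \subset A) F (indicator X) = 0) ->
  (vec_degree F <= w)%N.
Proof.
move=> h; apply/bigmax_leqP => i _; apply/bigmax_leqP => c /forallP hc.
apply/bigmax_leqP => A; apply: contraR; rewrite -ltnNge => /h /rowP /(_ i).
rewrite mxE summxE => FA.
by apply/eqP; rewrite -(anf_coef c A) -[RHS]FA; apply: eq_bigr => X _;
  apply/eqP.
Qed.

(** A product of #|D| additive maps expands into terms which depend on at most
    #|D| coordinates; each of them is unchanged when another element of A is
    added to X, so its sum over the subsets of A vanishes. *)
Lemma sum_prod_additive (L : fieldType) (I K : finType)
    (D : {set K}) (A : {set I})
    (v : K -> I -> L) : (forall z : L, z + z = 0) -> (#|D| < #|A|)%N ->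
  \sum_(X : {set I} | X \subset A) \prod_(k in D) \sum_(p in X) v k p = 0.
Proof.
move=> L2 DA; have [p0 _] : exists p, p \in A by apply/card_gt0P; lia.
transitivity (\sum_(X : {set I} | X \subset A)
    \sum_(f in pffun_on p0 (mem D) predT)
      \prod_(k in D) ((f k \in X)%:R * v k (f k))).
  apply: eq_bigr => X _.
  rewrite -(big_distr_big p0 (mem D) predT (fun k p => (p \in X)%:R * v k p)).
  apply: eq_bigr => k _; rewrite big_mkcond.
  by apply: eq_bigr => p _; case: (p \in X); rewrite ?mul1r ?mul0r.
rewrite exchange_big /=; apply: big1 => f _.
have [r rA rf] : exists2 r, r \in A & r \notin [set f k | k in D].
  apply/subsetPn; apply: contraL DA => /subset_leq_card h; rewrite -leqNgt.
  exact: leq_trans h (leq_imset_card _ _).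
apply: (sum_toggle L2 rA) => X /=; apply: eq_bigr => k kD.
have fr : f k != r by apply: contraNneq rf => <-; apply: imset_f.
by rewrite !inE fr (negPf fr).
Qed.

Lemma vec_degree_monomial n (L : fieldExtType 'F_2)
    (psi : {linear 'rV['F_2]_n.+1 -> L})
    (D : {set 'I_n.+1}) (F : 'rV['F_2]_n.+1 -> 'rV['F_2]_n.+1) :
  injective psi -> (forall y, psi (F y) = conj_monomial D (psi y)) ->
  (vec_degree F <= #|D|)%N.
Proof.
move=> inj_psi hF; apply: vec_degree_le => A DA; apply: inj_psi.
rewrite linear_sum linear0 -[RHS](sum_prod_additive
  (fun (k : 'I_n.+1) p => psi (delta_mx 0 p) ^+ (2 ^ k)) (@addL2 L) DA).
apply: eq_bigr => X _; rewrite hF; apply: eq_bigr => k _.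
by rewrite linear_sum frob_sum.
Qed.

(** * The trace form and the dot product *)

Section TraceForm.

Variables (n : nat) (L : fieldExtType 'F_2).
Variable psi : {linear 'rV['F_2]_n.+1 -> L}.
Hypothesis bij_psi : bijective psi.
Implicit Types u v : 'rV['F_2]_n.+1.

Lemma trace_dotE u v : (trace_dot psi u v)%:A = ftrace n (psi u * psi v).
Proof. exact: (abs_traceE bij_psi). Qed.

Lemma trace_dotC u v : trace_dot psi u v = trace_dot psi v u.
Proof. by rewrite /trace_dot mulrC. Qed.

Definition trace_dual u : 'rV['F_2]_n.+1 :=
  \row_i trace_dot psi u (delta_mx 0 i).

Lemma dot_trace_dual u v : dot (trace_dual u) v = trace_dot psi u v.
Proof.
apply: (fmorph_inj (in_alg L)); rewrite /= trace_dotE /dot scaler_suml.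
rewrite [v in RHS]row_sum_delta linear_sum mulr_sumr.
rewrite (big_morph (@ftrace n L) (@ftraceD n L) (_ : _ = 0)); last first.
  by rewrite /ftrace big1 // => i _; rewrite expr0n expn_eq0.
apply: eq_bigr => i _; rewrite mxE linearZ /= mulrC -scalerA trace_dotE.
case: (F2_cases (v 0 i)) => ->; rewrite ?scale0r ?scale1r // mulr0.
by rewrite /ftrace big1 // => j _; rewrite expr0n expn_eq0.
Qed.

Lemma dot_trace_dualr u v : dot u (trace_dual v) = trace_dot psi v u.
Proof. by rewrite dotC dot_trace_dual. Qed.

Lemma trace_dual_inj : injective trace_dual.
Proof.
move=> u v uv; apply: (bij_inj bij_psi).
apply/eqP; rewrite -addL2_eq0; apply/eqP.
have [psi' _ psiK] := bij_psi.
apply: (ftrace_nondeg bij_psi) => t; rewrite mulrDl ftraceD -[t]psiK.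
rewrite -!trace_dotE.
by rewrite -!dot_trace_dual uv addL2.
Qed.

Lemma trace_dualD u v : trace_dual (u + v) = trace_dual u + trace_dual v.
Proof.
apply/rowP => i; rewrite !mxE; apply: (fmorph_inj (in_alg L)).
by rewrite rmorphD /= !trace_dotE linearD mulrDl ftraceD.
Qed.

Lemma trace_dual0 : trace_dual 0 = 0.
Proof. by apply: (addrI (trace_dual 0)); rewrite -trace_dualD !addr0. Qed.

Lemma derive_trace_dual (P : 'rV['F_2]_n.+1 -> 'rV['F_2]_n.+1) b y :
  derive b (fun y => trace_dual (P y)) y = trace_dual (derive b P y).
Proof. by rewrite /derive trace_dualD. Qed.

Lemma property_P1_trace_dual (P : 'rV['F_2]_n.+1 -> 'rV['F_2]_n.+1) :
  property_P1 P -> property_P1 (fun y => trace_dual (P y)).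
Proof.
move=> hP v w vw h; apply: (hP v w vw) => y; apply: trace_dual_inj.
by rewrite trace_dual0 -(h y) /derive -!trace_dualD.
Qed.

Lemma trace_dot_derive_nonconstant (P : 'rV['F_2]_n.+1 -> 'rV['F_2]_n.+1) d :
    injective P -> monomial_via psi d P -> (2 < vec_degree P)%N ->
  forall a b, a != 0 -> b != 0 -> forall c,
    ~ (forall y, trace_dot psi a (derive b P y) = c).
Proof.
move=> injP hd degP a b a0 b0 c h.
have [psi' psi'K psiK] := bij_psi; have inj_psi := bij_inj bij_psi.
have d0 : (0 < d)%N.
  case: d hd => // hd; suff /eqP : b = 0 by rewrite (negPf b0).
  by apply: injP; apply: inj_psi; rewrite !hd.
have [D hD] := exp_conj_monomial bij_psi d0.
have PD y : psi (P y) = conj_monomial D (psi y) by rewrite hd hD.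
have injD : injective (conj_monomial (L := L) D).
  move=> z t; rewrite -[z]psiK -[t]psiK -!PD.
  by move=> /inj_psi /injP ->.
have D3 : (2 < #|D|)%N := leq_trans degP (vec_degree_monomial inj_psi PD).
have psi0 x : x != 0 -> psi x != 0 by rewrite -(inj_eq inj_psi) linear0.
apply: (trace_derive_monomial_nonconstant bij_psi injD D3 (psi0 a a0)
  (psi0 b b0) (c := c%:A)).
move=> z; rewrite -(h (psi' z)) trace_dotE /derive linearD !PD.
by rewrite linearD psiK.
Qed.

End TraceForm.

Theorem corollary6p6 (m : nat) (hm : (4 <= m)%N)
    (pi : {perm 'rV['F_2]_m}) (hP1 : property_P1 pi) :
  ((forall a1 b2 : 'rV['F_2]_m, a1 != 0 -> b2 != 0 ->
      ~ (forall y, dot a1 (derive b2 pi y) = 0)) ->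
   let f := D0_fun (@dot m) pi in
   [/\ bent f,
       ~ class_MM_sharp f,
       l_optimal f
     & (forall a1 b2 : 'rV['F_2]_m, a1 != 0 -> b2 != 0 ->
          ~ (forall y, dot a1 (derive b2 pi y) = 1)) ->
       r_ind f = 1%N]) /\
  (forall (L : fieldExtType 'F_2) (psi : {linear 'rV['F_2]_m -> L}) (d : nat),
     bijective psi -> monomial_via psi d pi -> (2 < vec_degree pi)%N ->
     forall sp : 'rV['F_2]_m -> 'rV['F_2]_m -> 'F_2,
       sp = @dot m \/ sp = trace_dot psi ->
       let f := D0_fun sp pi in
       [/\ bent f, ~ class_MM_sharp f, l_optimal f & r_ind f = 1%N]).
Proof.
split=> [nz f | L psi d].
  exact: (spiked_MM_conclusion hm perm_inj hP1).
case: m hm pi hP1 psi => // n hm pi hP1 psi bij_psi hd degpi.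
have nonconst := trace_dot_derive_nonconstant bij_psi perm_inj hd degpi.
move=> sp [] -> f.
  (* Every dot product with a fixed vector is a trace form. *)
  have [u_of _ Tu] := injF_bij (trace_dual_inj bij_psi).
  have dotE a v : dot a v = trace_dot psi (u_of a) v.
    by rewrite -(dot_trace_dual bij_psi) Tu.
  have nc a b : a != 0 -> b != 0 -> forall c,
      ~ (forall y, dot a (derive b pi y) = c).
    move=> a0 b0 c h; apply: (nonconst (u_of a) b _ b0 c) => [|y].
      by apply: contraNneq a0 => ua; rewrite -(Tu a) ua trace_dual0.
    by rewrite -dotE.
  have [|? ? ? hr] := spiked_MM_conclusion hm perm_inj hP1
    (fun z => erefl (f z)).
    by move=> a b a0 b0; apply: nc.
  by split=> //; apply: hr => a b a0 b0; apply: nc.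
pose P y := trace_dual psi (pi y).
have nc a b : a != 0 -> b != 0 -> forall c,
    ~ (forall y, dot a (derive b P y) = c).
  move=> a0 b0 c h; apply: (nonconst a b a0 b0 c) => y.
  rewrite -(h y) (derive_trace_dual bij_psi) (dot_trace_dualr bij_psi).
  exact: trace_dotC.
have injP : injective P by move=> y y' /(trace_dual_inj bij_psi) /perm_inj.
have fE z : f z = dot (lsubmx z) (P (rsubmx z)) + delta0 (lsubmx z).
  by rewrite (dot_trace_dualr bij_psi) trace_dotC.
have [|? ? ? hr] := spiked_MM_conclusion hm injP
  (property_P1_trace_dual bij_psi hP1) fE.
  by move=> a b a0 b0; apply: nc.
by split=> //; apply: hr => a b a0 b0; apply: nc.
Qed.
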